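(* The linear time-invariant discrete-time system $x_{k+1}=Ax_k+Gd_k$, $y_k=Cx_k+Hd_k$ is strongly detectable if and only if either of the following (equivalent) conditions holds: (i) $\mathrm{rk}\begin{bmatrix}zI-A&-G\\ C&H\end{bmatrix}=n+p$ for all $z\in\mathbb{C}$ with $|z|\ge1$; (ii) $\mathrm{rk}\begin{bmatrix}zI-\hat A&-G_2\\ C_2&0\end{bmatrix}=n+p-p_H$ for all $z\in\mathbb{C}$ with $|z|\ge1$. These conditions are equivalent to the property that the system is minimum-phase, i.e. the invariant zeros of the system matrices $\begin{bmatrix}zI-A&-G\\ C&H\end{bmatrix}$ and $\begin{bmatrix}zI-\hat A&-G_2\\ C_2&0\end{bmatrix}$ are stable.
   Context: Here $x_k\in\mathbb{R}^n$, $d_k\in\mathbb{R}^p$ is an arbitrary unknown input, $y_k\in\mathbb{R}^l$; this is the noise-free version (with known inputs omitted) of $x_{k+1}=Ax_k+Bu_k+Gd_k+w_k$, $y_k=Cx_k+Du_k+Hd_k+v_k$, where $v_k$ has covariance $R\succ0$. Standing assumptions: $n\ge l\ge1$, $l\ge p\ge0$, $\mathrm{rk}[G^\top\ H^\top]=p$. Strong detectability: the system is strongly detectable if $y_k=0$ for all $k\ge0$ implies $x_k\to0$ as $k\to\infty$, for all input sequences and initial states. Notation: $p_H:=\mathrm{rk}(H)$; singular value decomposition $H=\begin{bmatrix}U_1&U_2\end{bmatrix}\begin{bmatrix}\Sigma&0\\ 0&0\end{bmatrix}\begin{bmatrix}V_1^\top\\ V_2^\top\end{bmatrix}$ with $\Sigma\in\mathbb{R}^{p_H\times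 p_H}$ diagonal of full rank, $[U_1\ U_2]$, $[V_1\ V_2]$ unitary; $G_1=GV_1$, $G_2=GV_2$, $T_1=U_1^\top-U_1^\top RU_2(U_2^\top RU_2)^{-1}U_2^\top$, $C_1=T_1C$, $C_2=U_2^\top C$, $\hat A:=A-G_1\Sigma^{-1}C_1$. Operations with empty matrices are allowed. An invariant zero of one of these system matrices is a $z\in\mathbb{C}$ at which the matrix is rank deficient (fails to have full column rank, $n+p$ respectively $n+p-p_H$); it is stable if $|z|<1$. *)

(* Defs.v *)
From mathcomp Require Import all_boot all_order all_algebra.
From mathcomp Require Import all_classical all_reals all_analysis.
From mathcomp.real_closed Require Import complex.

Set Implicit Arguments.
Unset Strict Implicit.
Unset Printing Implicit Defensive.

Import Order.TTheory GRing.Theory Num.Theory.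
Import numFieldNormedType.Exports.

Local Open Scope classical_set_scope.
Local Open Scope complex_scope.
Local Open Scope ring_scope.

Definition posdef_mx (R : realType) (m : nat) (W : 'M[R]_m) : Prop :=
  W^T = W /\ forall v : 'cV[R]_m, v != 0 -> 0 < (v^T *m W *m v) 0 0.

(* Row and column dimensions are kept apart because the block matrices used
   below have width [r + (m - r)]; the two equations together force [m = k]. *)
Definition orthogonal_mx (R : realType) (m k : nat) (Q : 'M[R]_(m, k)) : Prop :=
  Q^T *m Q = 1%:M /\ Q *m Q^T = 1%:M.

Definition is_svd (R : realType) (l p : nat) (H : 'M[R]_(l, p))
    (U1 : 'M[R]_(l, \rank H)) (U2 : 'M[R]_(l, l - \rank H))
    (Sigma : 'M[R]_(\rank H))
    (V1 : 'M[R]_(p, \rank H)) (V2 : 'M[R]_(p, p - \rank H)) : Prop :=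
  [/\ H = row_mx U1 U2 *m block_mx Sigma 0 0 0 *m col_mx V1^T V2^T,
      is_diag_mx Sigma,
      \rank Sigma = \rank H,
      orthogonal_mx (row_mx U1 U2)
    & orthogonal_mx (row_mx V1 V2)].

Fixpoint state (R : realType) (n p : nat) (A : 'M[R]_n) (G : 'M[R]_(n, p))
    (x0 : 'cV[R]_n) (d : nat -> 'cV[R]_p) (k : nat) : 'cV[R]_n :=
  if k is j.+1 then A *m state A G x0 d j + G *m d j else x0.

Definition output (R : realType) (n p l : nat) (A : 'M[R]_n)
    (G : 'M[R]_(n, p)) (C : 'M[R]_(l, n)) (H : 'M[R]_(l, p))
    (x0 : 'cV[R]_n) (d : nat -> 'cV[R]_p) (k : nat) : 'cV[R]_l :=
  C *m state A G x0 d k + H *m d k.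

Definition strongly_detectable (R : realType) (n p l : nat) (A : 'M[R]_n)
    (G : 'M[R]_(n, p)) (C : 'M[R]_(l, n)) (H : 'M[R]_(l, p)) : Prop :=
  forall (x0 : 'cV[R]_n) (d : nat -> 'cV[R]_p),
    (forall k, output A G C H x0 d k = 0) ->
    state A G x0 d k @[k --> \oo] --> (0 : 'cV[R]_n).

Definition mxC (R : realType) (m n : nat) (M : 'M[R]_(m, n)) : 'M[R[i]]_(m, n) :=
  map_mx (real_complex R) M.

Definition system_matrix (R : realType) (n p l : nat) (A : 'M[R]_n)
    (G : 'M[R]_(n, p)) (C : 'M[R]_(l, n)) (H : 'M[R]_(l, p)) (z : R[i]) :
    'M[R[i]]_(n + l, n + p) :=
  block_mx (z%:M - mxC A) (- mxC G) (mxC C) (mxC H).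

Definition invariant_zero (R : realType) (m k : nat)
    (P : R[i] -> 'M[R[i]]_(m, k)) (z : R[i]) : Prop :=
  (\rank (P z) < k)%N.

Definition stable_zeros (R : realType) (m k : nat)
    (P : R[i] -> 'M[R[i]]_(m, k)) : Prop :=
  forall z : R[i], invariant_zero P z -> `|z| < 1.

(* Main.v *)
Require Import Defs.
From mathcomp Require Import all_boot all_order all_algebra.
From mathcomp Require Import all_classical all_reals all_analysis.
From mathcomp.real_closed Require Import complex.
From mathcomp Require Import lra zify.

(** Zero-output trajectories are the solutions of a linear recurrence driven
    by the system matrix.  With [w_k] the stacked vector of [x_k] and [d_k],
    having zero output means [E w_(k+1) = M w_k], where [E = diag(I, 0)] and
    [zE - M] is the system matrix [P(z)].

    If [P(z)] has full column rank whenever [|z| >= 1], then every state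
    decays.  Read [P] as a matrix over [C[X]], where [X] acts on sequences by
    the shift; then [P] annihilates [w].  The polynomials [g] for which
    [L P = g I] has a polynomial solution [L] form an ideal, and every such [g]
    annihilates all coordinates of [w].  At a point [z] where [P(z)] has a
    constant left inverse [B], the determinant of [B P(X)] is in the ideal
    (take for [L] the adjugate times [B]) and equals 1 at [z].  Hence no point
    with [|z| >= 1] is a common zero of the ideal, and by Bezout the ideal
    contains a nonzero [g] with all its roots in the open unit disc.  Removing
    the linear factors of [g] one at a time, each step being the scalar
    contraction [y_(k+1) = a y_k + o(1)] with [|a| < 1], gives [w_k -> 0].
    This is [pencil_cvg0].

    Conversely, a nonzero kernel vector [(x, d)] of [P(z)] with [|z| >= 1]
    gives the complex trajectory [z^k x] with input [z^k d] and zero output.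
    Its real and imaginary parts are real trajectories with zero output, so
    strong detectability forces [z^k x -> 0], hence [x = 0]; then [G d = 0] and
    [H d = 0], and the rank assumption on [G] and [H] gives [d = 0].  This is
    [rank_of_strongly_detectable].

    Conditions (i) and (ii) agree point by point in [z], since the kernels of
    the two system matrices correspond to each other.  In the coordinates of
    the singular value decomposition the output equation splits into
    [C1 x + Sigma d1 = 0], which determines the input component [d1] as
    [- Sigma^-1 C1 x], and [C2 x = 0]; substituting [d1] turns [A] into [Ahat].
    This is [ker_decoupling].  Finally, the minimum-phase property restates
    both rank conditions by contraposition. *)

Set Implicit Arguments.
Unset Strict Implicit.
Unset Printing Implicit Defensive.

Import Order.TTheory GRing.Theory Num.Theory.
Import numFieldNormedType.Exports.

Local Open Scope classical_set_scope.
Local Open Scope complex_scope.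
Local Open Scope ring_scope.

(** * Polynomials in the shift operator acting on sequences *)

Definition shift_act (F : comNzRingType) (q : {poly F}) (y : nat -> F) (k : nat) : F :=
  \sum_(i < size q) q`_i * y (k + i)%N.

Section ShiftAction.
Variable F : comNzRingType.
Implicit Types (p q : {poly F}) (y : nat -> F) (k : nat).

Lemma shift_actE n q y k : (size q <= n)%N ->
  shift_act q y k = \sum_(i < n) q`_i * y (k + i)%N.
Proof.
move=> qn; rewrite /shift_act (big_ord_widen _ (fun i => q`_i * y (k + i)%N) qn).
rewrite big_mkcond; apply: eq_bigr => i _; case: ltnP => // /(nth_default 0) ->.
by rewrite mul0r.
Qed.

Lemma shift_actD p q y k : shift_act (p + q) y k = shift_act p y k + shift_act q y k.
Proof.
have ps := leq_maxl (size p) (size q); have qs := leq_maxr (size p) (size q).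
rewrite (shift_actE _ _ (size_polyD p q)) (shift_actE _ _ ps) (shift_actE _ _ qs).
by rewrite -big_split; apply: eq_bigr => i _; rewrite coefD mulrDl.
Qed.

Lemma shift_actZ c q y k : shift_act (c *: q) y k = c * shift_act q y k.
Proof.
rewrite (shift_actE _ _ (size_scale_leq c q)) /shift_act mulr_sumr.
by apply: eq_bigr => i _; rewrite coefZ mulrA.
Qed.

Lemma shift_act0 y k : shift_act 0 y k = 0.
Proof. by rewrite /shift_act size_poly0 big_ord0. Qed.

Lemma shift_act1 y k : shift_act 1 y k = y k.
Proof. by rewrite /shift_act size_poly1 big_ord1 coefC mul1r addn0. Qed.

Lemma shift_actMX q y k : shift_act (q * 'X) y k = shift_act q y k.+1.
Proof.
have sz : (size (q * 'X)%R <= (size q).+1)%N.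
  by apply: leq_trans (size_polyMleq _ _) _; rewrite size_polyX addn2.
rewrite (shift_actE _ _ sz) big_ord_recl coefMX mul0r add0r.
by apply: eq_bigr => i _; rewrite coefMX /= /bump /= add1n addnS addSn.
Qed.

Lemma shift_act_sum (I : finType) (q : I -> {poly F}) y k :
  shift_act (\sum_j q j) y k = \sum_j shift_act (q j) y k.
Proof.
by apply: (big_morph (fun q => shift_act q y k)) => [p r|]; rewrite (shift_actD, shift_act0).
Qed.

Lemma shift_act_sumr (I : finType) q (y : I -> nat -> F) k :
  shift_act q (fun k => \sum_j y j k) k = \sum_j shift_act q (y j) k.
Proof. by rewrite exchange_big; apply: eq_bigr => i _; rewrite mulr_sumr. Qed.

(** The shift turns sequences into a module over the polynomial ring; this is
    what lets polynomial matrices be multiplied before they act. *)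
Lemma shift_actM p q y k : shift_act (p * q) y k = shift_act p (shift_act q y) k.
Proof.
elim/poly_ind: p k => [|p c IHp] k; first by rewrite mul0r !shift_act0.
rewrite mulrDl mulrAC -[c%:P]mulr1 mul_polyC -scalerAl mul1r !shift_actD !shift_actMX.
by rewrite !shift_actZ IHp shift_act1.
Qed.

Lemma shift_act_XsubC a y k : shift_act ('X - a%:P) y k = y k.+1 - a * y k.
Proof.
rewrite shift_actD -polyCN -[X in shift_act X _ _ + _]mul1r shift_actMX shift_act1.
by rewrite -[(- a)%:P]mulr1 mul_polyC shift_actZ shift_act1 mulNr.
Qed.

(** Applying [L] to the system [P w = 0] leaves the decoupled equations
    [g w_j = 0]. *)
Lemma shift_act_left_inverse m n (P : 'M[{poly F}]_(m, n)) (L : 'M[{poly F}]_(n, m)) (g : {poly F})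
    (w : nat -> 'cV[F]_n) :
    L *m P = g%:M ->
    (forall i k, \sum_j shift_act (P i j) (fun k => w k j 0) k = 0) ->
  forall j k, shift_act g (fun k => w k j 0) k = 0.
Proof.
move=> LP Pw j k.
transitivity (\sum_i shift_act ((L *m P) j i) (fun k => w k i 0) k).
  rewrite LP (bigD1 j) //= mxE eqxx mulr1n big1 ?addr0 // => j' /negPf jj'.
  by rewrite mxE eq_sym jj' mulr0n shift_act0.
under eq_bigr do rewrite mxE shift_act_sum; rewrite exchange_big /=.
rewrite big1 // => i _; under eq_bigr do rewrite shift_actM; rewrite -shift_act_sumr.
rewrite (_ : (fun k => _) = fun=> 0); first by rewrite /shift_act big1 // => ? _; rewrite mulr0.
by apply/funext => k'; exact: Pw.
Qed.
End ShiftAction.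

(** * Annihilating polynomials of a matrix pencil *)

Section Pencil.
Variable F : fieldType.
Implicit Types g h : {poly F}.

(** A principal ideal domain argument without a generator: as long as [g] has a
    root in [S], some [h] of the ideal does not vanish there, and the greatest
    common divisor of [g] and [h] is an element of smaller degree. *)
Lemma poly_ideal_avoid (J : {poly F} -> Prop) (S : F -> Prop) :
    (forall g h, J g -> J h -> J (g + h)) -> (forall q g, J g -> J (q * g)) ->
    (exists z, S z) -> (forall z, S z -> exists2 g, J g & g.[z] != 0) ->
  exists g, [/\ J g, g != 0 & forall z, S z -> ~~ root g z].
Proof.
move=> JD JM [z0 Sz0] JS.
have [g0 Jg0 g0z] := JS _ Sz0.
have {g0z} g0n0 : g0 != 0 by apply: contraNneq g0z => ->; rewrite horner0.
have [n] := ubnP (size g0); elim: n => // n IHn in g0 Jg0 g0n0 *; rewrite ltnS => g0n.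
have [Sg0|] := pselect (forall z, S z -> ~~ root g0 z); first by exists g0.
move=> /existsNP[z /not_implyP[Sz /negP]]; rewrite negbK => g0z.
have [h Jh hz] := JS _ Sz; have [[u v] /= /eqp_dvdl uvE] := Bezoutp g0 h.
(* The Bezout combination [e] is associate to the gcd and lies in the ideal. *)
set e := u * g0 + v * h in uvE.
have eg0 : e %| g0 by rewrite uvE dvdp_gcdl.
have eh : e %| h by rewrite uvE dvdp_gcdr.
have en0 : e != 0 by apply: contraTneq eg0 => ->; rewrite dvd0p.
apply: (IHn e) => //; first by apply: JD; apply: JM.
(* Were the degrees equal, [e] would share the root [z] with [g0], and so
   would its multiple [h]. *)
apply: leq_trans g0n; rewrite ltn_neqAle dvdp_leq // andbT.
apply: contra hz => /eqP seg; rewrite -rootE; apply: root_dvdp eh _.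
by rewrite (eqp_root (q := g0)) // -(dvdp_size_eqp eg0) seg.
Qed.

Definition poly_pencil m n (E M : 'M[F]_(m, n)) : 'M[{poly F}]_(m, n) :=
  'X *: map_mx polyC E - map_mx polyC M.

Lemma map_poly_pencil m n (E M : 'M[F]_(m, n)) z :
  map_mx (horner_eval z) (poly_pencil E M) = z *: E - M.
Proof. by apply/matrixP => i j; rewrite !mxE /horner_eval !hornerE. Qed.

(** A constant left inverse [B] of the pencil at [z] makes [B P(X)] a square
    polynomial matrix whose determinant is 1 at [z]; its adjugate then provides
    a polynomial left inverse of [P] up to that determinant. *)
Lemma poly_pencil_left_inverse m n (E M : 'M[F]_(m, n)) z :
    row_full (z *: E - M) ->
  exists2 g, (exists L, L *m poly_pencil E M = g%:M) & g.[z] != 0.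
Proof.
move=> /row_fullP[B BP]; set Q := map_mx polyC B *m poly_pencil E M.
exists (\det Q).
  by exists (\adj Q *m map_mx polyC B); rewrite -mulmxA mul_adj_mx.
rewrite -[_.[z]]/(horner_eval z (\det Q)) -det_map_mx map_mxM map_poly_pencil.
rewrite -map_mx_comp map_mx_id ?BP ?det1 ?oner_eq0 // => x.
by rewrite /= /horner_eval hornerC.
Qed.

Lemma poly_pencil_act m n (E M : 'M[F]_(m, n)) (w : nat -> 'cV[F]_n) :
    (forall k, E *m w k.+1 = M *m w k) ->
  forall i k, \sum_j shift_act (poly_pencil E M i j) (fun k => w k j 0) k = 0.
Proof.
move=> Ew i k; transitivity ((E *m w k.+1 - M *m w k) i 0); last by rewrite Ew subrr mxE.
rewrite !mxE -sumrB; apply: eq_bigr => j _.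
rewrite !mxE mulrC shift_actD shift_actMX -polyCN -[(E i j)%:P]mulr1 -[(- _)%:P]mulr1.
by rewrite !mul_polyC !shift_actZ !shift_act1 mulNr.
Qed.

End Pencil.

(** * Decay of the solutions of a recurrence with stable roots *)

Section Decay.
Variable R : realType.
Import Normc.

Lemma cvg0_contraction (r : R) (u v : nat -> R) :
    0 <= r < 1 -> (forall k, 0 <= u k) -> (forall k, u k.+1 <= r * u k + v k) ->
    v k @[k --> \oo] --> (0 : R) ->
  u k @[k --> \oo] --> (0 : R).
Proof.
move=> /andP[r0 r1] u0 urv v0; apply/cvgr0Pnorm_lt => e e0.
have d0 : 0 < (1 - r) * (e / 2) by apply: mulr_gt0; lra.
have /cvgr0Pnorm_lt/(_ _ d0)[N _ Nv] := v0.
(* [e / 2] is the fixed point of [t |-> r t + (1 - r) (e / 2)], so it absorbs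
   the perturbation from step [N] on. *)
have uN j : u (N + j)%N <= u N * r ^+ j + e / 2.
  elim: j => [|j IHj]; first by rewrite addn0 mulr1; lra.
  have := Nv (N + j)%N (leq_addr _ _); rewrite /= => /ltr_normlW vj.
  rewrite addnS exprS; apply: le_trans (urv _) _.
  have := ler_wpM2l r0 IHj; lra.
have rj : u N * r ^+ j @[j --> \oo] --> (0 : R).
  rewrite -(mulr0 (u N)); apply: cvgM; first exact: cvg_cst.
  by apply: cvg_expr; rewrite ger0_norm.
have e20 : 0 < e / 2 by lra.
have /cvgr0Pnorm_lt/(_ _ e20)[N' _ Nr] := rj.
exists (N + N')%N => // k /= Nk; rewrite ger0_norm //.
have kE : k = (N + (k - N))%N by lia.
have := uN (k - N)%N; rewrite -kE.
have := Nr (k - N)%N; rewrite /= => /(_ ltac:(lia)) /ltr_normlW; lra.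
Qed.

Lemma normc_ge0 (x : R[i]) : 0 <= normc x.
Proof. by case: x => a b; exact: sqrtr_ge0. Qed.

Lemma norm_normc (x : R[i]) : `|x| = (normc x)%:C.
Proof. by case: x. Qed.

(** Sequences are measured by their real-valued modulus [normc], so that limits
    are taken in [R]. *)
Lemma shift_act_prod_cvg0 (s : seq R[i]) (y : nat -> R[i]) :
    (forall a, a \in s -> `|a| < 1) ->
    normc (shift_act (\prod_(a <- s) ('X - a%:P)) y k) @[k --> \oo] --> (0 : R) ->
  normc (y k) @[k --> \oo] --> (0 : R).
Proof.
elim: s => [_|a s IHs sa].
  by rewrite big_nil; under eq_fun do rewrite shift_act1.
rewrite big_cons => Sy; apply: IHs => [b bs|]; first by rewrite sa // inE bs orbT.
apply: (@cvg0_contraction (normc a) _ _ _ _ _ Sy) => [|k|k]; rewrite ?normc_ge0 //=.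
  by rewrite -ltcR -norm_normc sa ?mem_head.
rewrite shift_actM shift_act_XsubC -normcM; set t := shift_act _ y.
by rewrite -{1}[t k.+1](subrK (a * t k)) addrC; exact: le_normcD.
Qed.

(** Membership of [g] in the ideal means that [g I] is a left multiple of the
    pencil; the rank hypothesis says that the ideal has no common zero outside
    the open unit disc. *)
Lemma pencil_cvg0 m n (E M : 'M[R[i]]_(m, n)) (w : nat -> 'cV[R[i]]_n) :
    (forall z : R[i], 1 <= `|z| -> row_full (z *: E - M)) ->
    (forall k, E *m w k.+1 = M *m w k) ->
  forall j, normc (w k j 0) @[k --> \oo] --> (0 : R).
Proof.
move=> EM Ew j.
have [||||g [[L LP] g0 gz]] :=
  @poly_ideal_avoid _ (fun g => exists L, L *m poly_pencil E M = g%:M)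
                      (fun z => 1 <= `|z|).
- move=> g h [L1 L1P] [L2 L2P]; exists (L1 + L2).
  by rewrite mulmxDl L1P L2P raddfD.
- by move=> q g [L LP]; exists (q *: L); rewrite -scalemxAl LP scale_scalar_mx.
- by exists 1; rewrite normr1.
- by move=> z z1; apply: poly_pencil_left_inverse; exact: EM.
have Sg k := shift_act_left_inverse LP (poly_pencil_act Ew) j k.
have [s gE] := closed_field_poly_normal g.
apply: (@shift_act_prod_cvg0 s) => [a sa|].
  rewrite real_ltNge ?realE ?normr_ge0 ?ler01 //; apply/negP => /gz.
  by rewrite gE rootZ ?lead_coef_eq0 // root_prod_XsubC sa.
rewrite [X in X @ _](_ : _ = fun=> 0); first exact: cvg_cst.
apply/funext => k; move: (Sg k); rewrite {1}gE shift_actZ => /eqP.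
by rewrite mulf_eq0 lead_coef_eq0 (negPf g0) /= => /eqP ->; rewrite normc0.
Qed.
End Decay.

(** * Decoupling the input components that act on the output *)

Lemma mxrank_col_kerP (F : fieldType) m n (M : 'M[F]_(m, n)) :
  \rank M = n <-> forall v : 'cV_n, M *m v = 0 -> v = 0.
Proof.
split=> [/eqP /row_fullP[B BM] v Mv|Minj].
  by rewrite -[v]mul1mx -BM -mulmxA Mv mulmx0.
apply/eqP; rewrite -mxrank_tr -/(row_free M^T); apply: inj_row_free => v vM.
by rewrite -[v]trmxK; rewrite (Minj v^T) ?trmx0 // -[M]trmxK -trmx_mul vM trmx0.
Qed.

Section Decoupling.
Variables (F : fieldType) (n p l r s t : nat).
Variables (A : 'M[F]_n) (G : 'M[F]_(n, p)) (C : 'M[F]_(l, n)) (H : 'M[F]_(l, p)).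
(* [T1] and [T2] are the row transformations of the output, [W1] and [W2] the
   inverse coordinate change on the input; [col_mx T1 T2] has the inverse
   [row_mx U1 N].  Stated without transposes, the identities make sense over
   any field and carry over from the real matrices to their complex images. *)
Variables (U1 : 'M[F]_(l, r)) (N : 'M[F]_(l, t)) (T1 : 'M[F]_(r, l)) (T2 : 'M[F]_(t, l)).
Variable (S : 'M[F]_r).
Variables (V1 : 'M[F]_(p, r)) (V2 : 'M[F]_(p, s)) (W1 : 'M[F]_(r, p)) (W2 : 'M[F]_(s, p)).
Hypothesis HE : H = U1 *m S *m W1.
Hypothesis S_unit : S \in unitmx.
Hypotheses (T1U1 : T1 *m U1 = 1%:M) (T2U1 : T2 *m U1 = 0).
Hypothesis UT : U1 *m T1 + N *m T2 = 1%:M.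
Hypotheses (W1V1 : W1 *m V1 = 1%:M) (W1V2 : W1 *m V2 = 0).
Hypotheses (W2V1 : W2 *m V1 = 0) (W2V2 : W2 *m V2 = 1%:M).
Hypothesis VW : V1 *m W1 + V2 *m W2 = 1%:M.

Let Ahat := A - G *m V1 *m invmx S *m (T1 *m C).

(** The first input component is determined by the state through
    [T1 (C x + H d) = 0]; eliminating it is a bijection between the kernels. *)
Lemma ker_decoupling (z : F) :
  (forall v : 'cV_(n + p), block_mx (z%:M - A) (- G) C H *m v = 0 -> v = 0) <->
  (forall v : 'cV_(n + s),
     block_mx (z%:M - Ahat) (- (G *m V2)) (T2 *m C) 0 *m v = 0 -> v = 0).
Proof.
have AhatE : z%:M - Ahat = z%:M - A + G *m V1 *m invmx S *m (T1 *m C).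
  by rewrite /Ahat opprB addrCA addrC.
split=> Pinj v; rewrite -[v]vsubmxK; move: (usubmx v) (dsubmx v) => x d {v};
  rewrite mul_block_col => /eqP; rewrite col_mx_eq0 => /andP[/eqP xE /eqP yE].
- pose d1 := - (invmx S *m (T1 *m C *m x)).
  have := Pinj (col_mx x (V1 *m d1 + V2 *m d)).
  rewrite mul_block_col.
  have -> : (z%:M - A) *m x + - G *m (V1 *m d1 + V2 *m d) = 0.
    rewrite -[RHS]xE AhatE [in RHS]mulmxDl mulmxDr /d1.
    by rewrite !mulmxN !mulNmx !mulmxA opprK addrA.
  have -> : C *m x + H *m (V1 *m d1 + V2 *m d) = 0.
    rewrite HE mulmxDr !mulmxA -(mulmxA _ W1) W1V1 mulmx1 -(mulmxA _ W1) W1V2 mulmx0 mul0mx.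
    rewrite addr0 /d1 mulmxN !mulmxA mulmxK // -{1}[C]mul1mx -UT mulmxDl mulmxDl.
    rewrite addrAC subrr add0r.
    by move: yE; rewrite mul0mx addr0 => yE; rewrite -!mulmxA (mulmxA T2) yE mulmx0.
  rewrite col_mx0 => /(_ erefl) /eqP; rewrite col_mx_eq0 => /andP[/eqP -> /eqP /(congr1 (mulmx W2))].
  by rewrite mulmxDr !mulmxA W2V1 W2V2 mul0mx mul1mx add0r mulmx0 => ->; rewrite col_mx0.
- have HdE : H *m d = U1 *m (S *m (W1 *m d)) by rewrite HE !mulmxA.
  have dE : d = V1 *m (W1 *m d) + V2 *m (W2 *m d) by rewrite !mulmxA -mulmxDl VW mul1mx.
  have T1y : T1 *m C *m x = - (S *m (W1 *m d)).
    apply/eqP; rewrite -addr_eq0; move: (congr1 (mulmx T1) yE).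
    by rewrite mulmx0 HdE mulmxDr [T1 *m (U1 *m _)]mulmxA T1U1 mul1mx mulmxA => ->.
  have T2y : T2 *m C *m x = 0.
    move: (congr1 (mulmx T2) yE).
    by rewrite mulmx0 HdE mulmxDr [T2 *m (U1 *m _)]mulmxA T2U1 mul0mx addr0 mulmxA.
  have := Pinj (col_mx x (W2 *m d)); rewrite mul_block_col T2y mul0mx addr0.
  have -> : (z%:M - Ahat) *m x + - (G *m V2) *m (W2 *m d) = 0.
    rewrite -[RHS]xE AhatE mulmxDl -(mulmxA (_ *m _ *m _)) T1y.
    by rewrite mulmxN !mulNmx -!mulmxA mulKmx // [in RHS]dE mulmxDr opprD addrA.
  rewrite col_mx0 => /(_ erefl) /eqP; rewrite col_mx_eq0 => /andP[/eqP x0 /eqP d2].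
  move: T1y; rewrite x0 mulmx0 => /esym/eqP; rewrite oppr_eq0 => /eqP/(congr1 (mulmx (invmx S))).
  rewrite mulKmx // mulmx0 => d1.
  by rewrite dE d1 d2 !mulmx0 addr0 col_mx0.
Qed.
End Decoupling.

(** * Strong detectability and the rank condition *)

Section StrongDetectability.
Variable R : realType.
Import Normc.

Lemma cvg_mx0P m n (x : nat -> 'M[R]_(m, n)) :
  x k @[k --> \oo] --> (0 : 'M[R]_(m, n)) <->
  (forall i j, x k i j @[k --> \oo] --> (0 : R)).
Proof.
split=> x0.
  move=> i j; apply/cvgr0Pnorm_lt => e e0; have /cvgr0Pnorm_lt/(_ _ e0) := x0.
  apply: filterS => k; apply: le_lt_trans.
  rewrite [leRHS]/Num.Def.normr /= mx_normrE; apply/bigmax_geP; right => /=.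
  by exists (i, j).
apply/cvgr0Pnorm_lt => e e0.
have : \forall k \near \oo, forall i j, `|x k i j| < e.
  apply: filter_forall => i; apply: filter_forall => j.
  by have /cvgr0Pnorm_lt/(_ _ e0) := x0 i j.
apply: filterS => k xe.
by rewrite [ltLHS]/Num.Def.normr /= mx_normrE; apply/bigmax_ltP; split=> // -[i j] _ /=.
Qed.

Variables (n p l : nat).
Variables (A : 'M[R]_n) (G : 'M[R]_(n, p)) (C : 'M[R]_(l, n)) (H : 'M[R]_(l, p)).

Lemma system_matrix_pencil z :
  system_matrix A G C H z =
  z *: block_mx 1%:M 0 0 0 - block_mx (mxC A) (mxC G) (- mxC C) (- mxC H).
Proof.
rewrite /system_matrix scale_block_mx opp_block_mx add_block_mx !scaler0 !sub0r !opprK.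
by rewrite scalemx1.
Qed.

(** The real trajectory, embedded into the complex numbers, solves the
    recurrence of the pencil; the rank condition is the hypothesis of
    [pencil_cvg0]. *)
Lemma strongly_detectable_of_rank :
    (forall z : R[i], 1 <= `|z| -> \rank (system_matrix A G C H z) = (n + p)%N) ->
  strongly_detectable A G C H.
Proof.
move=> rkP x0 d y0; apply/cvg_mx0P => i j; rewrite ord1 => {j}.
pose w k : 'cV[R[i]]_(n + p) := col_mx (mxC (state A G x0 d k)) (mxC (d k)).
have Ew k : block_mx 1%:M 0 0 0 *m w k.+1 =
    block_mx (mxC A) (mxC G) (- mxC C) (- mxC H) *m w k.
  rewrite !mul_block_col !mul0mx mul1mx !addr0 !mulNmx -opprD.
  rewrite -!map_mxM -!map_mxD; congr col_mx.
  by rewrite -/(output A G C H x0 d k) y0 map_mx0 oppr0.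
have rkE z : 1 <= `|z| ->
    row_full (z *: block_mx 1%:M 0 0 0 - block_mx (mxC A) (mxC G) (- mxC C) (- mxC H)).
  by move=> z1; rewrite -system_matrix_pencil /row_full rkP.
have := pencil_cvg0 rkE Ew (lshift p i).
under eq_fun do rewrite /w col_mxEu mxE /= expr0n /= addr0 sqrtr_sqr.
by move=> ?; apply/norm_cvg0P.
Qed.

(** The real and imaginary parts are treated together: both are [R]-linear maps
    to [R], and such maps carry complex trajectories to real ones. *)
Definition real_functional (f : R[i] -> R) :=
  {morph f : a b / a + b} /\ forall (a : R) b, f (a%:C * b) = a * f b.

Lemma Re_functional : real_functional (@complex.Re R).
Proof. by split=> [[a b] [c e]|a [b c]] //=; rewrite mul0r subr0. Qed.

Lemma Im_functional : real_functional (@complex.Im R).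
Proof. by split=> [[a b] [c e]|a [b c]] //=; rewrite mul0r addr0. Qed.

Lemma map_mx_functional f m q r (M : 'M[R]_(m, q)) (v : 'M[R[i]]_(q, r)) :
  real_functional f -> map_mx f (mxC M *m v) = M *m map_mx f v.
Proof.
move=> [fD fZ]; have f0 : f 0 = 0 by rewrite -(mul0r 0) -(rmorph0 (real_complex R)) fZ mul0r.
apply/matrixP => i j; rewrite !mxE (big_morph f fD f0).
by apply: eq_bigr => k _; rewrite !mxE fZ.
Qed.

Lemma map_mxD_functional f m q (v w : 'M[R[i]]_(m, q)) :
  real_functional f -> map_mx f (v + w) = map_mx f v + map_mx f w.
Proof. by move=> [fD _]; apply/matrixP => i j; rewrite !mxE fD. Qed.

(** A kernel vector of the system matrix at [z] generates the geometric
    trajectory [z^k x] under the input [z^k d], with zero output. *)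
Section EigenTrajectory.
Variables (z : R[i]) (x : 'cV[R[i]]_n) (d : 'cV[R[i]]_p) (f : R[i] -> R).
Hypothesis fP : real_functional f.
Hypothesis xE : mxC A *m x + mxC G *m d = z *: x.
Hypothesis yE : mxC C *m x + mxC H *m d = 0.

Lemma state_eigen k :
  state A G (map_mx f x) (fun j => map_mx f (z ^+ j *: d)) k = map_mx f (z ^+ k *: x).
Proof.
elim: k => [|k IHk] /=; first by rewrite expr0 scale1r.
rewrite IHk -!map_mx_functional // -map_mxD_functional // -!scalemxAr -scalerDr xE.
by rewrite scalerA exprSr.
Qed.

Lemma output_eigen k :
  output A G C H (map_mx f x) (fun j => map_mx f (z ^+ j *: d)) k = 0.
Proof.
rewrite /output state_eigen -!map_mx_functional // -map_mxD_functional //.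
rewrite -!scalemxAr -scalerDr yE scaler0; apply/matrixP => i j; rewrite !mxE.
by rewrite -(mul0r 0) -(rmorph0 (real_complex R)) (proj2 fP) mul0r.
Qed.
End EigenTrajectory.

(** Since [|z^k x_i| >= |x_i|], a geometric trajectory outside the open unit
    disc can only vanish in the limit if [x = 0]; the remaining input [d] is
    excluded by the rank condition on [G] and [H]. *)
Lemma rank_of_strongly_detectable (z : R[i]) :
    \rank (row_mx G^T H^T) = p -> strongly_detectable A G C H -> 1 <= `|z| ->
  \rank (system_matrix A G C H z) = (n + p)%N.
Proof.
move=> rkGH sd z1; apply/mxrank_col_kerP => v; rewrite -[v]vsubmxK.
move: (usubmx v) (dsubmx v) => x d {v}; rewrite mul_block_col => /eqP.
rewrite col_mx_eq0 => /andP[/eqP xE /eqP yE].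
have {xE} xE : mxC A *m x + mxC G *m d = z *: x.
  apply/esym/eqP; rewrite -subr_eq0 -[X in _ == X]xE mulmxBl mul_scalar_mx mulNmx.
  by rewrite opprD addrA.
have fx f : real_functional f -> forall i, f (z ^+ k * x i 0) @[k --> \oo] --> (0 : R).
  move=> fP i; have := sd _ _ (output_eigen fP xE yE).
  move=> /cvg_mx0P/(_ i 0); apply: cvg_trans; apply: near_eq_cvg.
  by near=> k; rewrite (state_eigen fP xE) !mxE.
have x0 : x = 0.
  apply/matrixP => i j; rewrite ord1 mxE {j}; apply: eq0_normc; apply/eqP.
  rewrite -sqrf_eq0 eq_le sqr_ge0 andbT.
  have sq : complex.Re (z ^+ k * x i 0) ^+ 2 + complex.Im (z ^+ k * x i 0) ^+ 2 @[k --> \oo] --> (0 : R).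
    have fx2 f : real_functional f -> f (z ^+ k * x i 0) ^+ 2 @[k --> \oo] --> (0 : R).
      by move=> fP; rewrite -(mulr0 (0 : R)); exact: cvgM (fx f fP i) (fx f fP i).
    by rewrite -(addr0 (0 : R)); exact: cvgD (fx2 _ Re_functional) (fx2 _ Im_functional).
  apply: (cvgr_to_ge sq); near=> k.
  have -> : complex.Re (z ^+ k * x i 0) ^+ 2 + complex.Im (z ^+ k * x i 0) ^+ 2 = normc (z ^+ k * x i 0) ^+ 2.
    by case: (_ * _) => a b /=; rewrite sqr_sqrtr // addr_ge0 ?sqr_ge0.
  rewrite lerXn2r ?nnegrE ?normc_ge0 // -lecR -!norm_normc normrM normrX.
  by rewrite ler_peMl ?exprn_ege1.
move: xE yE; rewrite x0 !mulmx0 !add0r scaler0 => Gd Hd.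
have : \rank (mxC (col_mx G H)) = p by rewrite mxrank_map -mxrank_tr tr_col_mx.
move=> /mxrank_col_kerP/(_ d) ->; first by rewrite col_mx0.
by rewrite /mxC map_col_mx mul_col_mx Gd Hd col_mx0.
Unshelve. all: by end_near.
Qed.

End StrongDetectability.

(** * Invariant zeros and the equivalence of the two rank conditions *)

Lemma stable_zerosP (R : realType) m k (P : R[i] -> 'M[R[i]]_(m, k)) :
  (forall z, 1 <= `|z| -> \rank (P z) = k) <-> stable_zeros P.
Proof.
split=> [rkP z|sP z z1].
  rewrite /invariant_zero => rkz; rewrite real_ltNge ?realE ?normr_ge0 ?ler01 //.
  by apply/negP => /rkP; move: rkz => /[swap] ->; rewrite ltnn.
apply/eqP; rewrite eqn_leq rank_leq_col /= leqNgt; apply/negP => /sP.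
by move=> z_lt1; have := lt_le_trans z_lt1 z1; rewrite ltxx.
Qed.

Theorem theorem7 (R : realType) (n l p : nat)
    (A : 'M[R]_n) (G : 'M[R]_(n, p)) (C : 'M[R]_(l, n)) (H : 'M[R]_(l, p))
    (W : 'M[R]_l)
    (U1 : 'M[R]_(l, \rank H)) (U2 : 'M[R]_(l, l - \rank H))
    (Sigma : 'M[R]_(\rank H))
    (V1 : 'M[R]_(p, \rank H)) (V2 : 'M[R]_(p, p - \rank H))
    (l_gt0 : (1 <= l)%N) (le_l_n : (l <= n)%N) (le_p_l : (p <= l)%N)
    (rank_GH : \rank (row_mx G^T H^T) = p)
    (W_posdef : posdef_mx W)
    (H_svd : is_svd U1 U2 Sigma V1 V2) :
  let G1 := G *m V1 in
  let G2 := G *m V2 in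
  let T1 := U1^T - U1^T *m W *m U2 *m invmx (U2^T *m W *m U2) *m U2^T in
  let C1 := T1 *m C in
  let C2 := U2^T *m C in
  let Ahat := A - G1 *m invmx Sigma *m C1 in
  let P := system_matrix A G C H in
  let Phat := system_matrix Ahat G2 C2 0 in
  let cond_i := forall z : R[i], 1 <= `|z| -> \rank (P z) = (n + p)%N in
  let cond_ii :=
    forall z : R[i], 1 <= `|z| -> \rank (Phat z) = (n + p - \rank H)%N in
  let minimum_phase := stable_zeros P /\ stable_zeros Phat in
  [/\ strongly_detectable A G C H <-> cond_i,
      strongly_detectable A G C H <-> cond_ii,
      cond_i <-> cond_ii,
      cond_i <-> minimum_phase
    & cond_ii <-> minimum_phase].
Proof.
move=> G1 G2 T1 C1 C2 Ahat P Phat cond_i cond_ii minimum_phase.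
have sd_i : strongly_detectable A G C H <-> cond_i.
  split=> [sd z z1|]; last exact: strongly_detectable_of_rank.
  exact: rank_of_strongly_detectable.
have [HE _ rkS [UtU UUt] [VtV VVt]] := H_svd.
have S_unit : Sigma \in unitmx by rewrite -row_free_unit /row_free rkS.
rewrite mul_row_block !mulmx0 !addr0 mul_row_col mul0mx addr0 in HE.
move: UtU UUt VtV VVt; rewrite !tr_row_mx !mul_col_row !mul_row_col.
rewrite !(scalar_mx_block _ _ (1 : R)).
move=> /eq_block_mx[U11 U12 U21 U22] UUt /eq_block_mx[V11 V12 V21 V22] VVt.
(* [col_mx T1 U2^T] is [col_mx U1^T U2^T] with [K] times the second block row
   subtracted from the first, so its inverse is [row_mx U1 (U2 + U1 K)]. *)
pose K := U1^T *m W *m U2 *m invmx (U2^T *m W *m U2).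
have T1U1 : T1 *m U1 = 1%:M by rewrite /T1 -/K mulmxBl -mulmxA U21 mulmx0 subr0.
have UT : U1 *m T1 + (U2 + U1 *m K) *m U2^T = 1%:M.
  by rewrite /T1 -/K mulmxBr mulmxDl -UUt [U1 *m (K *m _)]mulmxA addrA addrAC addrNK addrC.
have i_ii : cond_i <-> cond_ii.
  have rkP z : \rank (P z) = (n + p)%N <-> \rank (Phat z) = (n + p - \rank H)%N.
    rewrite -addnBA ?rank_leq_col // !mxrank_col_kerP.
    have /(congr1 (@mxC R _ _)) := HE; rewrite /mxC !map_mxM => HEC.
    have := ker_decoupling (mxC A) (mxC G) (mxC C) (U1 := mxC U1)
      (N := mxC (U2 + U1 *m K)) (T1 := mxC T1) (T2 := mxC U2^T) (S := mxC Sigma)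
      (V1 := mxC V1) (V2 := mxC V2) (W2 := mxC V2^T) HEC _ _ _ _ _ _ _ _ _ z.
    rewrite /P /Phat /system_matrix /mxC -map_invmx -!map_mxM -map_mxB -!map_mxD map_unitmx.
    rewrite T1U1 U21 UT V11 V12 V21 V22 VVt !map_mx1 !map_mx0 -[T1 *m C]/C1.
    exact.
  by split=> rk z z1; apply/rkP; exact: rk.
have i_mp : cond_i <-> minimum_phase.
  split=> [ci|[/stable_zerosP //]]; split; apply/stable_zerosP => //.
  by move=> z z1; rewrite (i_ii.1 ci z z1) addnBA ?rank_leq_col.
by split=> //; tauto.
Qed.
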